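(* Let $\{E_N\}_{N\in\mathbb N}$ be a sequence of $N\times N$ random matrices with independent complex-valued entries of mean zero and unit variance. Let $\varrho_N$ denote the spectral radius of $N^{-1/2}E_N$, i.e. the maximum modulus of its eigenvalues. Then the sequence $\{\varrho_N\}_{N\in\mathbb N}$ is tight.
   Context: Unit variance means $\mathbb E|e|^2=1$ for a centered entry $e$. Tight means $\lim_{R\to\infty}\sup_N\mathbb P(\varrho_N>R)=0$. *)

(* Defs.v *)
From HB Require Import structures.
From mathcomp Require Export all_boot all_order all_algebra.
From mathcomp Require Export all_classical all_reals all_analysis.
From mathcomp Require Export complex.

Set Implicit Arguments.
Unset Strict Implicit.
Unset Printing Implicit Defensive.

Import Order.TTheory GRing.Theory Num.Theory.
Import numFieldNormedType.Exports.

Local Open Scope classical_set_scope.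
Local Open Scope ring_scope.

Definition cmod (R : realType) (z : R[i]) : R := ComplexField.Normc.normc z.

(* R[i] carries no measurable structure in the library: its Borel sets are
   taken to be those of R * R under this identification. *)
Definition reim (R : realType) (z : R[i]) : R * R :=
  (complex.Re z, complex.Im z).

Section ComplexRandomVariables.
Context (d : measure_display) (T : measurableType d) (R : realType).
Variable P : probability T R.

Definition complex_rv (X : T -> R[i]) : Prop :=
  measurable_fun [set: T] (fun w => reim (X w)).

(* The integrability hypothesis ensures that the two expectations below are
   the actual expectations, the library's integral being a total function. *)
Definition centered (X : T -> R[i]) : Prop :=
  [/\ P.-integrable [set: T] (fun w => (cmod (X w))%:E),
      ('E_P[fun w => complex.Re (X w)] = 0)%E
    & ('E_P[fun w => complex.Im (X w)] = 0)%E].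

(* E|X|^2 = 1, which is the variance of X only when X is centered. *)
Definition unit_variance (X : T -> R[i]) : Prop :=
  ('E_P[fun w => (cmod (X w) ^+ 2)%R] = 1)%E.

Definition mutually_independent (I : finType) (X : I -> T -> R[i]) : Prop :=
  forall (J : {set I}) (B : I -> set (R * R)),
    (forall i, i \in J -> measurable (B i)) ->
    P (\bigcap_(i in [set` J]) [set w | B i (reim (X i w))]) =
    (\prod_(i in J) P [set w | B i (reim (X i w))])%E.

End ComplexRandomVariables.

Arguments complex_rv {d T R} X.

(* The set is finite and nonempty since the size is n.+1 and R[i] is
   algebraically closed, so the supremum is a maximum. *)
Definition spectral_radius (R : realType) (n : nat) (A : 'M[R[i]]_n.+1) : R :=
  sup [set cmod l | l in [set l : R[i] | eigenvalue A l]].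

Definition tight (R : realType) (d : nat -> measure_display)
    (T : forall N, measurableType (d N)) (P : forall N, probability (T N) R)
    (X : forall N, T N -> R) : Prop :=
  ereal_sup (range (fun N => P N [set w | r < X N w])) @[r --> +oo%R]
    --> (0 : \bar R)%E.

(* Main.v *)
Require Import Defs.
From mathcomp Require Import perm measurable_realfun ring lra.

Set Implicit Arguments.
Unset Strict Implicit.
Unset Printing Implicit Defensive.

Import Order.TTheory GRing.Theory Num.Theory.
Import numFieldNormedType.Exports.
Import HBNNSimple.

Local Open Scope classical_set_scope.
Local Open Scope complex_scope.
Local Open Scope ring_scope.

(** Let E have size N.  The eigenvalues of A = N^(-1/2) E are hard to reach
directly, but the coefficients of its characteristic polynomial are under
control in mean square.  The coefficient of X^(N-k) is, up to a factor
N^(-k/2) and signs, the sum over pairs (J, s), with J a set of k indices and s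
a permutation moving only elements of J, of the monomials prod_(i in J)
E_(i, s i).  Distinct pairs give distinct sets of entries, so by independence,
centering and unit variance these monomials are orthonormal in L^2
([cexp_monomial], [second_moment_monomials]).  Their number is N(N-1)...(N-k+1),
at most N^k, so every coefficient of the characteristic polynomial of A has
second moment at most 1 ([second_moment_coef_char_poly]).

If A has an eigenvalue of modulus larger than r > 1, dividing the
characteristic equation by its leading term shows that the coefficients a_k of
X^(N-k), k >= 1, satisfy 1 <= sum_k |a_k| r^(-k) ([ge1_sum_char_poly]).  Since
|a_k| <= (1 + |a_k|^2)/2, Markov's inequality bounds the probability of this
event by sum_(k >= 1) r^(-k) = 1/(r - 1), uniformly in N
([spectral_radius_tail]), and this tends to 0 as r tends to infinity.

Two points support this argument.  The orthogonality of the monomials requires the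
expectation of a product of independent complex variables, which is derived
from the product rule for events one variable at a time
([ge0_integral_prod_indep], [cexp_prod_indep]).  And the event that the
spectral radius exceeds r must be shown to be measurable before it can be
compared with another one: it is a countable union, over Gaussian rationals z,
of conditions on the value of the characteristic polynomial at z
([spectral_radius_gt_rat]). *)

(** * Modulus and measurability of complex-valued functions *)

Section ComplexModulus.
Context (R : realType).
Implicit Types z : R[i].

Lemma cmod_ge0 z : 0 <= cmod z.
Proof. by case: z => x y; exact: sqrtr_ge0. Qed.

Lemma cmodM z1 z2 : cmod (z1 * z2) = cmod z1 * cmod z2.
Proof. exact: ComplexField.Normc.normcM. Qed.

Lemma cmod1 : cmod (1 : R[i]) = 1.
Proof. exact: ComplexField.Normc.normc1. Qed.

Lemma cmod_eq0 z : (cmod z == 0) = (z == 0).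
Proof.
apply/eqP/eqP => [|->]; first exact: ComplexField.Normc.eq0_normc.
exact: ComplexField.Normc.normc0.
Qed.

Lemma cmodD z1 z2 : cmod (z1 + z2) <= cmod z1 + cmod z2.
Proof. exact: le_normcD. Qed.

Lemma cmodN z : cmod (- z) = cmod z.
Proof. exact: normcN. Qed.

Lemma cmodX z n : cmod (z ^+ n) = cmod z ^+ n.
Proof. by elim: n => [|n IHn]; rewrite ?cmod1// !exprS cmodM IHn. Qed.

Lemma cmod_prod (I : Type) (s : seq I) (F : I -> R[i]) :
  cmod (\prod_(i <- s) F i) = \prod_(i <- s) cmod (F i).
Proof. exact: (big_morph (@cmod R) cmodM cmod1). Qed.

Lemma cmod_sum (I : Type) (s : seq I) (F : I -> R[i]) :
  cmod (\sum_(i <- s) F i) <= \sum_(i <- s) cmod (F i).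
Proof.
elim/big_ind2 : _ => [|x1 x2 y1 y2 h1 h2|//].
  by rewrite le_eqVlt (eqP (_ : cmod 0 == 0)) ?eqxx// cmod_eq0.
by apply: le_trans (cmodD _ _) _; exact: lerD.
Qed.

Lemma cmodr (x : R) : cmod x%:C = `|x|.
Proof. by rewrite /cmod /= expr0n addr0 sqrtr_sqr. Qed.

Lemma cmod_sqr z : cmod z ^+ 2 = complex.Re z ^+ 2 + complex.Im z ^+ 2.
Proof. by case: z => x y; rewrite sqr_sqrtr// addr_ge0 ?sqr_ge0. Qed.

Lemma mul_conjc z : z * z^* = (cmod z ^+ 2)%:C.
Proof. by rewrite cmod_sqr; case: z => x y /=; simpc; congr Complex; ring. Qed.

Lemma le_Re_cmod z : `|complex.Re z| <= cmod z.
Proof. by rewrite -lecR; exact: normc_ge_Re. Qed.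

Lemma le_Im_cmod z : `|complex.Im z| <= cmod z.
Proof.
rewrite -(ler_pXn2r (n := 2))// ?nnegrE ?cmod_ge0//.
by rewrite cmod_sqr real_normK ?num_real// lerDr sqr_ge0.
Qed.

Lemma le_cmod_ReIm z : cmod z <= `|complex.Re z| + `|complex.Im z|.
Proof.
rewrite -(ler_pXn2r (n := 2))// ?nnegrE ?cmod_ge0 ?addr_ge0//.
rewrite cmod_sqr sqrrD !real_normK ?num_real// -addrA lerD2l lerDr.
by rewrite mulrn_wge0// mulr_ge0.
Qed.

End ComplexModulus.

Section ComplexMeasurability.
Context (d : measure_display) (T : measurableType d) (R : realType).
Implicit Types X Y : T -> R[i].

Lemma complex_rvP X : complex_rv X <->
  measurable_fun setT (fun w => complex.Re (X w)) /\
  measurable_fun setT (fun w => complex.Im (X w)).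
Proof. exact: measurable_fun_pairP. Qed.

Lemma complex_rv_cst z : complex_rv (fun _ : T => z : R[i]).
Proof. by apply/complex_rvP; split; exact: measurable_cst. Qed.

Lemma complex_rvD X Y : complex_rv X -> complex_rv Y ->
  complex_rv (fun w => X w + Y w).
Proof.
move=> /complex_rvP[X1 X2] /complex_rvP[Y1 Y2]; apply/complex_rvP; split.
  apply: (eq_measurable_fun (fun w => complex.Re (X w) + complex.Re (Y w))).
    by move=> w _; case: (X w) (Y w) => ? ? [].
  exact: measurable_funD.
apply: (eq_measurable_fun (fun w => complex.Im (X w) + complex.Im (Y w))).
  by move=> w _; case: (X w) (Y w) => ? ? [].
exact: measurable_funD.
Qed.

Lemma complex_rvM X Y : complex_rv X -> complex_rv Y ->
  complex_rv (fun w => X w * Y w).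
Proof.
move=> /complex_rvP[X1 X2] /complex_rvP[Y1 Y2]; apply/complex_rvP; split.
  apply: (eq_measurable_fun (fun w =>
      complex.Re (X w) * complex.Re (Y w) - complex.Im (X w) * complex.Im (Y w))).
    by move=> w _; case: (X w) (Y w) => ? ? [].
  by apply: measurable_funB; exact: measurable_funM.
apply: (eq_measurable_fun (fun w =>
    complex.Re (X w) * complex.Im (Y w) + complex.Im (X w) * complex.Re (Y w))).
  by move=> w _; case: (X w) (Y w) => ? ? [].
by apply: measurable_funD; exact: measurable_funM.
Qed.

Lemma complex_rv_conj X : complex_rv X -> complex_rv (fun w => (X w)^*).
Proof.
move=> /complex_rvP[X1 X2]; apply/complex_rvP; split.
  by apply: eq_measurable_fun X1 => w _; case: (X w).
apply: (eq_measurable_fun (fun w => - complex.Im (X w))).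
  by move=> w _; case: (X w).
exact: measurable_funN.
Qed.

Lemma complex_rv_sum (I : Type) (s : seq I) (Q : pred I) (X : I -> T -> R[i]) :
  (forall i, complex_rv (X i)) -> complex_rv (fun w => \sum_(i <- s | Q i) X i w).
Proof.
move=> mX; elim: s => [|i s IHs].
  by under eq_fun do rewrite big_nil; exact: complex_rv_cst.
under eq_fun do rewrite big_cons.
by case: (Q i) => //; exact: complex_rvD.
Qed.

Lemma complex_rv_prod (I : Type) (s : seq I) (Q : pred I) (X : I -> T -> R[i]) :
  (forall i, complex_rv (X i)) ->
  complex_rv (fun w => \prod_(i <- s | Q i) X i w).
Proof.
move=> mX; elim: s => [|i s IHs].
  by under eq_fun do rewrite big_nil; exact: complex_rv_cst.
under eq_fun do rewrite big_cons.
by case: (Q i) => //; exact: complex_rvM.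
Qed.

Lemma measurable_cmod_sqr X : complex_rv X ->
  measurable_fun setT (fun w => cmod (X w) ^+ 2).
Proof.
move=> /complex_rvP[X1 X2]; under eq_fun do rewrite cmod_sqr.
by apply: measurable_funD; exact: measurable_funX.
Qed.

End ComplexMeasurability.

(** * Expectation of a product of independent variables *)

Section ProductOfExpectations.
Context (d dV : measure_display) (T : measurableType d) (V : measurableType dV).
Context (R : realType) (P : probability T R).
Local Open Scope ereal_scope.

(** The identity is linear in f and stable under increasing limits, so it
passes from indicators to simple functions and then to nonnegative measurable
functions. *)
Lemma ge0_integral_indep_weight (X : T -> V) (W : T -> R) (c : R) :
    measurable_fun setT X -> measurable_fun setT W -> (forall x, (0 <= W x)%R) ->
    (0 <= c)%R ->
    (forall B, measurable B ->
      \int[P]_x (\1_B (X x) * W x)%:E = \int[P]_x (\1_B (X x))%:E * c%:E) ->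
  forall f : V -> R, measurable_fun setT f -> (forall v, (0 <= f v)%R) ->
    \int[P]_x (f (X x) * W x)%:E = \int[P]_x (f (X x))%:E * c%:E.
Proof.
move=> mX mW W0 c0 indic f mf f0.
have mfE : measurable_fun setT (EFin \o f) by exact/measurable_EFinP.
pose g := nnsfun_approx measurableT mfE.
have gf v : (g n v)%:E @[n --> \oo] --> (f v)%:E.
  by apply: (cvg_nnsfun_approx measurableT mfE) => // x _; rewrite lee_fin.
have gnd v : {homo (fun n => g n v) : n m / (n <= m)%N >-> (n <= m)%R}.
  by move=> n m nm; have /lefP := nd_nnsfun_approx measurableT mfE nm; apply.
have mgX n : measurable_fun setT (fun x => g n (X x)) by exact: measurableT_comp.
have simple n :
    \int[P]_x (g n (X x) * W x)%:E = \int[P]_x (g n (X x))%:E * c%:E.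
  pose r := finmap.enum_fset (fset_set (range (g n))).
  have gE v : g n v = (\sum_(y <- r) y * \1_(g n @^-1` [set y]) v)%R.
    by rewrite {1}fimfunE fsbig_finite//; exact: fimfunP.
  have yi0 y v : (0 <= y * \1_(g n @^-1` [set y]) v)%R.
    rewrite indicE; case: (boolP (v \in _)) => [|_]; last by rewrite mulr0.
    by rewrite inE mulr1 => /= <-.
  have mi y : measurable (g n @^-1` [set y]) by exact: measurable_funPTI.
  have mI y : measurable_fun setT (fun x => \1_(g n @^-1` [set y]) (X x) : R).
    by apply: (measurableT_comp (measurable_indic (mi y))).
  under eq_integral => x _ do rewrite gE mulr_suml -sumEFin.
  under [in RHS]eq_integral => x _ do rewrite gE -sumEFin.
  rewrite !ge0_integral_sum//.
  - rewrite ge0_sume_distrl; last first.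
      by move=> y _; apply: integral_ge0 => x _; rewrite lee_fin.
    apply: eq_bigr => y _.
    have [y0|y0] := leP 0%R y.
      under eq_integral => x _ do rewrite -mulrA EFinM.
      under [in RHS]eq_integral => x _ do rewrite EFinM.
      rewrite !ge0_integralZl_EFin// ?indic ?muleA//.
      + exact/measurable_EFinP.
      + by move=> x _; rewrite lee_fin mulr_ge0.
      + exact/measurable_EFinP/measurable_funM.
    rewrite !integral0_eq ?mul0e// => x _; rewrite preimage_nnfun0//.
      by rewrite indic0 mulr0.
    by rewrite indic0 mulr0 mul0r.
  - by move=> y; apply/measurable_EFinP; apply: measurable_funM.
  - by move=> y x _; rewrite lee_fin.
  - move=> y; apply/measurable_EFinP; apply: measurable_funM => //.
    exact: measurable_funM.
  - by move=> y x _; rewrite lee_fin mulr_ge0.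
(* both sides of the identity are monotone limits along the approximation *)
have cvgl : \int[P]_x (g n (X x) * W x)%:E @[n --> \oo] -->
    \int[P]_x (f (X x) * W x)%:E.
  have := @cvg_monotone_convergence _ _ _ P _ measurableT
    (fun n x => (g n (X x) * W x)%:E) _ _ _.
  rewrite (_ : \int[P]_x limn _ = \int[P]_x (f (X x) * W x)%:E); last first.
    apply: eq_integral => x _; apply/cvg_lim => //.
    under eq_fun do rewrite EFinM.
    by rewrite EFinM; apply: cvgeZr.
  apply.
  - by move=> n; apply/measurable_EFinP/measurable_funM.
  - by move=> n x _; rewrite lee_fin mulr_ge0.
  - by move=> x _ n m nm; rewrite lee_fin ler_wpM2r// gnd.
have cvgr : \int[P]_x (g n (X x))%:E @[n --> \oo] --> \int[P]_x (f (X x))%:E.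
  have := @cvg_monotone_convergence _ _ _ P _ measurableT
    (fun n x => (g n (X x))%:E) _ _ _.
  rewrite (_ : \int[P]_x limn _ = \int[P]_x (f (X x))%:E); last first.
    by apply: eq_integral => x _; apply/cvg_lim.
  apply.
  - by move=> n; apply/measurable_EFinP.
  - by move=> n x _; rewrite lee_fin.
  - by move=> x _ n m nm; rewrite lee_fin gnd.
apply: (cvg_unique _ cvgl) => //=.
under eq_fun do rewrite simple.
exact: cvgeZr.
Qed.

(** Independence is the case where every f i is an indicator.  The indicators
are replaced by arbitrary functions one index at a time: the other factors make
up a fixed weight, to which [ge0_integral_indep_weight] applies. *)
Lemma ge0_integral_prod_indep (I : finType) (X : I -> T -> V) :
    (forall i, measurable_fun setT (X i)) ->
    (forall B : I -> set V, (forall i, measurable (B i)) ->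
      P (\bigcap_i (X i @^-1` B i)) = \prod_i P (X i @^-1` B i)) ->
  forall f : I -> V -> R, (forall i, measurable_fun setT (f i)) ->
    (forall i v, (0 <= f i v)%R) ->
    (forall i, \int[P]_x (f i (X i x))%:E \is a fin_num) ->
  \int[P]_x (\prod_i f i (X i x))%:E = \prod_i \int[P]_x (f i (X i x))%:E.
Proof.
move=> mX indep f mf f0 ffin.
have mfX f' i : measurable_fun setT (f' : V -> R) ->
    measurable_fun setT (fun x => f' (X i x)).
  by move=> mf'; exact: measurableT_comp.
have mindic i B : measurable B -> measurable (X i @^-1` B).
  by move=> mB; rewrite -[X in measurable X]setTI; exact: mX.
have intindic i B : measurable B -> \int[P]_x (\1_B (X i x))%:E = P (X i @^-1` B).
  by move=> mB; rewrite -(setIT (X i @^-1` B)) -integral_indic//; exact: mindic.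
(* s lists the indices at which f i need not be an indicator *)
suff: forall (s : seq I), uniq s -> forall f : I -> V -> R,
    (forall i, measurable_fun setT (f i)) -> (forall i v, (0 <= f i v)%R) ->
    (forall i, \int[P]_x (f i (X i x))%:E \is a fin_num) ->
    (forall i, i \notin s -> exists2 B, measurable B & f i = \1_B) ->
    \int[P]_x (\prod_i f i (X i x))%:E = \prod_i \int[P]_x (f i (X i x))%:E.
  move=> /(_ (enum I) (enum_uniq _) f); apply => //.
  by move=> i; rewrite mem_enum.
elim=> [_|j s IHs /= /andP[js us]] {mf f0 ffin}f mf f0 ffin fs.
  have /choice[B fB] : forall i, exists B, measurable B /\ f i = \1_B.
    by move=> i; have [B mB ->] := fs i isT; exists B.
  have mB i := (fB i).1.
  rewrite (eq_bigr (fun i => P (X i @^-1` B i))); last first.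
    by move=> i _; rewrite (fB i).2 intindic.
  rewrite -indep// -(setIT (\bigcap_i _)) -integral_indic//; last first.
    by apply: fin_bigcap_measurable => // i _; exact: mindic.
  apply: eq_integral => x _; congr EFin.
  rewrite indicE; case: (boolP (x \in _)); rewrite ?inE.
    move=> xB; apply: big1 => i _; rewrite (fB i).2 indicE mem_set//.
    exact: xB.
  rewrite notin_setE => /existsNP[i /not_implyP[_ xB]].
  by rewrite (bigD1 i)//= (fB i).2 indicE memNset// mul0r.
pose W x := (\prod_(i | i != j) f i (X i x))%R.
have W0 x : (0 <= W x)%R by apply: prodr_ge0.
have mW : measurable_fun setT W.
  rewrite /W; under eq_fun => x do rewrite -big_filter.
  by apply: measurable_prod => i _; exact: mfX.
pose c := fine (\prod_(i | i != j) \int[P]_x (f i (X i x))%:E).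
have cE : c%:E = \prod_(i | i != j) \int[P]_x (f i (X i x))%:E.
  by rewrite /c fineK//; apply: prode_fin_num => i _.
have c0 : (0 <= c)%R.
  apply/fine_ge0/prode_ge0 => i _; apply: integral_ge0 => x _.
  by rewrite lee_fin.
rewrite [RHS](bigD1 j)//= -cE -(ge0_integral_indep_weight (W := W))//.
  by apply: eq_integral => x _; rewrite (bigD1 j).
move=> B mB; pose f' i := if i == j then \1_B else f i.
have f'j : f' j = \1_B by rewrite /f' eqxx.
have f'i i : i != j -> f' i = f i by rewrite /f' => /negPf ->.
have := IHs us f' _ _ _ _.
rewrite (bigD1 j)//= f'j cE.
under [in X in _ = _ * X]eq_bigr => i ij do rewrite f'i//.
move=> <- //.
- apply: eq_integral => x _; rewrite (bigD1 j)//= f'j; congr (_ * _)%:E.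
  by apply: eq_bigr => i ij; rewrite f'i.
- move=> i; have [->|ij] := eqVneq i j; first by rewrite f'j; exact: measurable_indic.
  by rewrite f'i.
- move=> i v; have [->|ij] := eqVneq i j; first by rewrite f'j indicE.
  by rewrite f'i.
- move=> i; have [->|ij] := eqVneq i j; last by rewrite f'i.
  rewrite f'j intindic// fin_num_measure//; exact: mindic.
- move=> i nis; have [->|ij] := eqVneq i j; first by exists B.
  by rewrite f'i//; apply: fs; rewrite inE negb_or ij.
Qed.

End ProductOfExpectations.

Section ComplexExpectation.
Context (d : measure_display) (T : measurableType d).
Context (R : realType) (P : probability T R).
Implicit Types X Y : T -> R[i].

Definition cintegrable X : Prop :=
  P.-integrable setT (EFin \o (fun w => complex.Re (X w))) /\
  P.-integrable setT (EFin \o (fun w => complex.Im (X w))).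

Definition cexp X : R[i] :=
  Complex (\int[P]_w complex.Re (X w))%R (\int[P]_w complex.Im (X w))%R.

Lemma cintegrable_cmod X : complex_rv X ->
  P.-integrable setT (fun w => (cmod (X w))%:E) -> cintegrable X.
Proof.
move=> /complex_rvP[mRe mIm] Xint; split.
  apply: le_integrable Xint => //; first exact/measurable_EFinP.
  by move=> w _; rewrite lee_fin (ger0_norm (cmod_ge0 _)) le_Re_cmod.
apply: le_integrable Xint => //; first exact/measurable_EFinP.
by move=> w _; rewrite lee_fin (ger0_norm (cmod_ge0 _)) le_Im_cmod.
Qed.

Lemma cintegrable_real (f : T -> R) : P.-integrable setT (EFin \o f) ->
  cintegrable (fun w => (f w)%:C).
Proof. by split => //; exact: integrable0. Qed.

Lemma cexp_real (f : T -> R) : cexp (fun w => (f w)%:C) = (\int[P]_w f w)%:C.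
Proof. by rewrite /cexp /= Rintegral_cst// mul0r. Qed.

Lemma cintegrableD X Y : cintegrable X -> cintegrable Y ->
  cintegrable (fun w => X w + Y w).
Proof.
move=> [X1 X2] [Y1 Y2]; split.
  apply: (eq_integrable _ _ _ _ (integrableD measurableT X1 Y1)) => // w _.
  by rewrite /=; case: (X w) (Y w) => ? ? [].
apply: (eq_integrable _ _ _ _ (integrableD measurableT X2 Y2)) => // w _.
by rewrite /=; case: (X w) (Y w) => ? ? [].
Qed.

Lemma cexpD X Y : cintegrable X -> cintegrable Y ->
  cexp (fun w => X w + Y w) = cexp X + cexp Y.
Proof.
move=> [X1 X2] [Y1 Y2]; rewrite /cexp; simpc; congr Complex.
  rewrite -RintegralD//; apply: eq_Rintegral => w _.
  by case: (X w) (Y w) => ? ? [].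
rewrite -RintegralD//; apply: eq_Rintegral => w _.
by case: (X w) (Y w) => ? ? [].
Qed.

Lemma cintegrableZ a X : cintegrable X -> cintegrable (fun w => a * X w).
Proof.
case: a => x y [X1 X2].
have X1' z := integrableZl measurableT z X1.
have X2' z := integrableZl measurableT z X2.
split.
  apply: (eq_integrable _ _ _ _ (integrableB measurableT (X1' x) (X2' y))) => //.
  by move=> w _ /=; case: (X w).
apply: (eq_integrable _ _ _ _ (integrableD measurableT (X2' x) (X1' y))) => //.
by move=> w _ /=; case: (X w).
Qed.

Lemma cexpZ a X : cintegrable X -> cexp (fun w => a * X w) = a * cexp X.
Proof.
case: a => x y [X1 X2].
have X1' z := integrableZl measurableT z X1.
have X2' z := integrableZl measurableT z X2.
rewrite /cexp; simpc; congr Complex.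
  rewrite -!RintegralZl// -RintegralB//; first last.
  - exact: X2'.
  - exact: X1'.
  by apply: eq_Rintegral => w _; case: (X w).
rewrite -!RintegralZl// -RintegralD//; first last.
- exact: X1'.
- exact: X2'.
by apply: eq_Rintegral => w _; case: (X w).
Qed.

Lemma cintegrable_conj X : cintegrable X -> cintegrable (fun w => (X w)^*).
Proof.
move=> [X1 X2]; split.
  by apply: (eq_integrable _ _ _ _ X1) => // w _ /=; case: (X w).
apply: (eq_integrable _ _ _ _ (integrableN X2)) => // w _ /=.
by case: (X w).
Qed.

Lemma cexp_conj X : cintegrable X -> cexp (fun w => (X w)^*) = (cexp X)^*.
Proof.
move=> [X1 X2]; rewrite /cexp /=; congr Complex.
  by apply: eq_Rintegral => w _; case: (X w).
rewrite -mulN1r -RintegralZl//; apply: eq_Rintegral => w _.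
by rewrite mulN1r; case: (X w).
Qed.

Lemma cintegrable_sum (I : Type) (s : seq I) (Q : pred I) (X : I -> T -> R[i]) :
  (forall i, Q i -> cintegrable (X i)) ->
  cintegrable (fun w => \sum_(i <- s | Q i) X i w).
Proof.
move=> Xint; elim: s => [|i s IHs].
  under eq_fun do rewrite big_nil.
  by apply: cintegrable_real; exact: integrable0.
under eq_fun do rewrite big_cons.
by case: (boolP (Q i)) => // Qi; apply: cintegrableD => //; exact: Xint.
Qed.

Lemma cexp_sum (I : Type) (s : seq I) (Q : pred I) (X : I -> T -> R[i]) :
  (forall i, Q i -> cintegrable (X i)) ->
  cexp (fun w => \sum_(i <- s | Q i) X i w) = \sum_(i <- s | Q i) cexp (X i).
Proof.
move=> Xint; elim: s => [|i s IHs].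
  rewrite big_nil; under eq_fun do rewrite big_nil.
  by rewrite (cexp_real (fun=> 0)) Rintegral_cst// mul0r.
rewrite big_cons; under eq_fun do rewrite big_cons.
case: (boolP (Q i)) => // Qi; rewrite cexpD ?IHs//; first exact: Xint.
exact: cintegrable_sum.
Qed.

End ComplexExpectation.

Section ProductOfComplexExpectations.
Context (d : measure_display) (T : measurableType d).
Context (R : realType) (P : probability T R).

(** The units 1, -1, i, -i, indexed by a sign and the choice of an axis; with
the nonnegative parts below they write a complex number as a combination of
four nonnegative reals. *)
Definition halfaxis_unit (t : bool * bool) : R[i] :=
  (-1) ^+ t.1 * (if t.2 then 'i else 1).

Definition halfaxis_part (t : bool * bool) (v : R * R) : R :=
  Num.max ((-1) ^+ t.1 * (if t.2 then v.2 else v.1)) 0.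

Lemma halfaxis_sum (z : R[i]) :
  z = \sum_t halfaxis_unit t * (halfaxis_part t (reim z))%:C.
Proof.
rewrite -(pair_bigA _ (fun b c =>
  halfaxis_unit (b, c) * (halfaxis_part (b, c) (reim z))%:C))/=.
have split_max (x : R) : x = Num.max x 0 - Num.max (- x) 0.
  by rewrite /Num.max oppr_lt0; case: ltgtP => [x0|x0|->]; ring.
rewrite !big_bool /halfaxis_unit /halfaxis_part /= !expr1 !expr0 !mul1r !mulN1r.
case: z => x y /=; rewrite [in LHS](split_max x) [in LHS](split_max y).
by simpc; congr Complex; ring.
Qed.

Lemma halfaxis_part_ge0 t v : 0 <= halfaxis_part t v.
Proof. by rewrite le_max lexx orbT. Qed.

Lemma measurable_halfaxis_part t : measurable_fun setT (halfaxis_part t).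
Proof.
apply: measurable_maxr; last exact: measurable_cst.
apply: measurable_funM; first exact: measurable_cst.
by case: t.2; [exact: measurable_snd|exact: measurable_fst].
Qed.

Lemma integrable_halfaxis_part t (X : T -> R[i]) : cintegrable P X ->
  P.-integrable setT (EFin \o (fun w => halfaxis_part t (reim (X w)))).
Proof.
move=> [X1 X2].
have mX : complex_rv X.
  by apply/complex_rvP; split; apply/measurable_EFinP;
     [case/integrableP: X1|case/integrableP: X2].
have mq : measurable_fun setT (EFin \o (fun w => halfaxis_part t (reim (X w)))).
  by apply/measurable_EFinP/(measurableT_comp (measurable_halfaxis_part t) mX).
have le_max (x : R) : `|Num.max ((-1) ^+ t.1 * x) 0| <= `|x|.
  case: t.1; rewrite ?mulN1r ?mul1r /Num.max; case: ltP; rewrite ?normr0 ?normrN//.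
case t2 : t.2.
  apply: (le_integrable _ mq _ X2) => // w _.
  by rewrite lee_fin /halfaxis_part t2.
apply: (le_integrable _ mq _ X1) => // w _.
by rewrite lee_fin /halfaxis_part t2.
Qed.

Lemma cexp_halfaxis (X : T -> R[i]) : cintegrable P X ->
  cexp P X =
  \sum_t halfaxis_unit t * (\int[P]_w halfaxis_part t (reim (X w)))%R%:C.
Proof.
move=> Xint.
have qint t := cintegrable_real (integrable_halfaxis_part t Xint).
transitivity (cexp P (fun w =>
    \sum_t halfaxis_unit t * (halfaxis_part t (reim (X w)))%:C)).
  by congr cexp; apply/funext => w; exact: halfaxis_sum.
rewrite cexp_sum => [|t _]; last exact: cintegrableZ.
by apply: eq_bigr => t _; rewrite cexpZ// cexp_real.
Qed.

(** Splitting every factor into its four nonnegative parts and expanding the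
product reduces both claims to [ge0_integral_prod_indep]; the same expansion,
read backwards, reassembles the product of the expectations. *)
Lemma cexp_prod_indep (I : finType) (X : I -> T -> R[i]) :
    (forall i, complex_rv (X i)) -> mutually_independent P X ->
    (forall i, cintegrable P (X i)) ->
  cintegrable P (fun w => \prod_i X i w) /\
  cexp P (fun w => \prod_i X i w) = \prod_i cexp P (X i).
Proof.
move=> mX indep Xint.
pose q (s : {ffun I -> bool * bool}) i w := halfaxis_part (s i) (reim (X i w)).
have qfin s i : (\int[P]_w (q s i w)%:E)%E \is a fin_num.
  by apply: integrable_fin_num => //; exact: integrable_halfaxis_part.
have intq s : (\int[P]_w (\prod_i q s i w)%:E = \prod_i \int[P]_w (q s i w)%:E)%E.
  apply: (ge0_integral_prod_indep (X := fun i w => reim (X i w)) mX _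
    (fun i => measurable_halfaxis_part (s i))) => //.
  - move=> B mB; have := indep [set: I]%SET B (fun i _ => mB i).
    rewrite (eq_bigl xpredT) => [<-|i]; last by rewrite inE.
    by congr (P _); apply/seteqP; split=> w wB i _; apply: wB; rewrite /= ?inE.
  - by move=> i v; exact: halfaxis_part_ge0.
  - by move=> i; exact: qfin.
have qint s : P.-integrable setT (EFin \o (fun w => \prod_i q s i w)).
  apply/integrableP; split.
    apply/measurable_EFinP/measurable_prod => i _.
    exact: measurableT_comp (measurable_halfaxis_part _) (mX i).
  rewrite (eq_integral (fun w => (\prod_i q s i w)%:E)).
    by rewrite intq ltey_eq prode_fin_num.
  move=> w _; rewrite /= ger0_norm//; apply: prodr_ge0 => i _.
  exact: halfaxis_part_ge0.
have prodE : (fun w => \prod_i X i w) = (fun w => \sum_(s : {ffun I -> bool * bool})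
    (\prod_i halfaxis_unit (s i)) * (\prod_i q s i w)%:C).
  apply/funext => w; under eq_bigr => i _ do rewrite (halfaxis_sum (X i w)).
  rewrite bigA_distr_bigA; apply: eq_bigr => s _.
  by rewrite big_split rmorph_prod.
have sint (s : {ffun I -> bool * bool}) := cintegrableZ (\prod_i halfaxis_unit (s i))
  (cintegrable_real (qint s)).
rewrite prodE; split; first exact: cintegrable_sum.
rewrite cexp_sum//.
under [RHS]eq_bigr => i _ do rewrite cexp_halfaxis//.
rewrite bigA_distr_bigA; apply: eq_bigr => s _.
rewrite cexpZ; last exact: cintegrable_real.
rewrite [RHS]big_split/=.
rewrite -(rmorph_prod (real_complex R)) cexp_real; congr (_ * _%:C).
rewrite /Rintegral intq (eq_bigr (fun i => (fine (\int[P]_w (q s i w)%:E)%E)%:E)).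
  by rewrite prodEFin.
by move=> i _; rewrite fineK.
Qed.

End ProductOfComplexExpectations.

(** * Orthonormality of square-free monomials *)

Section Monomials.
Context (d : measure_display) (T : measurableType d).
Context (R : realType) (P : probability T R).

Lemma mutually_independent_comp (I : finType) (X : I -> T -> R[i])
    (g : I -> R[i] -> R[i]) :
    (forall i, complex_rv (fun v : R * R => g i (v.1 +i* v.2))) ->
    mutually_independent P X ->
  mutually_independent P (fun i w => g i (X i w)).
Proof.
move=> mg indep J B mB.
pose B' i := [set v : R * R | B i (reim (g i (v.1 +i* v.2)))].
have B'E i : [set w | B i (reim (g i (X i w)))] = [set w | B' i (reim (X i w))].
  by apply/seteqP; split=> w; rewrite /B' /=; case: (X i w).
have mB' i : i \in J -> measurable (B' i).
  by move=> iJ; rewrite -[B' i]setTI; apply: mg => //; exact: mB.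
under eq_bigcapr => i _ do rewrite B'E.
by under eq_bigr => i _ do rewrite B'E; exact: indep.
Qed.

Definition monomial (I : finType) (X : I -> T -> R[i]) (S : {set I}) (w : T) :=
  \prod_(i in S) X i w.

(** The product is, entry by entry, a product of functions of independent
variables: 1, X, conj X or |X|^2 according to the membership of the index in S1
and S2.  An index belonging to exactly one of the two sets contributes a zero
mean; all other factors have mean 1. *)
Lemma cexp_monomial (I : finType) (X : I -> T -> R[i]) (S1 S2 : {set I}) :
    (forall i, complex_rv (X i)) -> mutually_independent P X ->
    (forall i, centered P (X i)) -> (forall i, unit_variance P (X i)) ->
  cintegrable P (fun w => monomial X S1 w * (monomial X S2 w)^*) /\
  cexp P (fun w => monomial X S1 w * (monomial X S2 w)^*) = (S1 == S2)%:R.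
Proof.
move=> mX indep cX vX.
pose g i (z : R[i]) := (if i \in S1 then z else 1) * (if i \in S2 then z^* else 1).
have prodE : (fun w => monomial X S1 w * (monomial X S2 w)^*) =
    (fun w => \prod_i g i (X i w)).
  apply/funext => w; rewrite /monomial rmorph_prod big_split.
  by rewrite [in LHS]big_mkcond [X in _ * X]big_mkcond.
have mg i d' (T' : measurableType d') (Y : T' -> R[i]) : complex_rv Y ->
    complex_rv (fun w => g i (Y w)).
  move=> mY; apply: complex_rvM.
    by case: (i \in S1) => //; exact: complex_rv_cst.
  by case: (i \in S2); [exact: complex_rv_conj|exact: complex_rv_cst].
have sqint i : P.-integrable setT (fun w => (cmod (X i w) ^+ 2)%:E).
  apply/integrableP; split.
    exact/measurable_EFinP/measurable_cmod_sqr.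
  under eq_integral do rewrite /= ger0_norm ?sqr_ge0//.
  by have := vX i; rewrite /unit_variance unlock => ->; exact: ltry.
have gint i : cintegrable P (fun w => g i (X i w)) /\
    cexp P (fun w => g i (X i w)) = ((i \in S1) == (i \in S2))%:R.
  have [Xint EX1 EX2] := cX i.
  have Xcint := cintegrable_cmod (mX i) Xint.
  have EX : cexp P (X i) = 0.
    rewrite /cexp; move: EX1 EX2; rewrite !unlock /Rintegral => -> ->.
    by [].
  rewrite /g; case: (i \in S1); case: (i \in S2).
  - under eq_fun do rewrite mul_conjc.
    split; first exact: cintegrable_real (sqint i).
    rewrite cexp_real /Rintegral.
    by have := vX i; rewrite /unit_variance unlock => ->.
  - by under eq_fun do rewrite mulr1.
  - under eq_fun do rewrite mul1r.
    by split; [exact: cintegrable_conj|rewrite cexp_conj// EX rmorph0].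
  - under eq_fun do rewrite mul1r.
    split.
      apply: (@cintegrable_real _ _ _ _ (fun=> 1)).
      exact: finite_measure_integrable_cst.
    rewrite (cexp_real _ (fun=> 1)) Rintegral_cst// mul1r.
    exact: (congr1 (fun x => (fine x)%:C) (probability_setT P)).
rewrite prodE; have [|||pint ->] :=
  @cexp_prod_indep _ _ _ P _ (fun i w => g i (X i w)).
- by move=> i; exact: mg.
- apply: mutually_independent_comp indep => i; apply: mg.
  by apply/complex_rvP; split; [exact: measurable_fst|exact: measurable_snd].
- by move=> i; case: (gint i).
split=> //; under eq_bigr => i _ do rewrite (gint i).2.
have [->|S12] := eqVneq S1 S2; first by rewrite big1// => i _; rewrite eqxx.
have [i S12i] : exists i, (i \in S1) != (i \in S2).
  apply/existsP; apply: contraNT S12 => /existsPn S12; apply/eqP/setP => i.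
  by have := S12 i; rewrite negbK => /eqP.
by rewrite (bigD1 i)//= (negPf S12i) mul0r.
Qed.

(** Parseval's identity for the orthonormal family of monomials. *)
Lemma second_moment_monomials (I J : finType) (X : I -> T -> R[i])
    (A : {pred J}) (c : J -> R[i]) (S : J -> {set I}) :
    (forall i, complex_rv (X i)) -> mutually_independent P X ->
    (forall i, centered P (X i)) -> (forall i, unit_variance P (X i)) ->
    {in A &, injective S} ->
  (\int[P]_w (cmod (\sum_(a in A) c a * monomial X (S a) w) ^+ 2)%:E =
   (\sum_(a in A) cmod (c a) ^+ 2)%:E)%E.
Proof.
move=> mX indep cX vX injS.
pose Z w := \sum_(a in A) c a * monomial X (S a) w.
have mM a := complex_rv_prod (index_enum I) (mem (S a)) mX.
have mZ : complex_rv Z.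
  by apply: complex_rv_sum => a; apply: complex_rvM; [exact: complex_rv_cst|exact: mM].
have MM a b := cexp_monomial (S a) (S b) mX indep cX vX.
have ZE : (fun w => (cmod (Z w) ^+ 2)%:C) = (fun w => \sum_(a in A) \sum_(b in A)
    (c a * (c b)^*) * (monomial X (S a) w * (monomial X (S b) w)^*)).
  apply/funext => w; rewrite -mul_conjc /Z rmorph_sum mulr_suml.
  apply: eq_bigr => a _; rewrite mulr_sumr; apply: eq_bigr => b _.
  by rewrite rmorphM/=; ring.
have intZab a b := cintegrableZ (c a * (c b)^*) (MM a b).1.
have intZa a := @cintegrable_sum _ _ _ P _ (index_enum J) [in A]
   _ (fun b _ => intZab a b).
have intZ : P.-integrable setT (fun w => (cmod (Z w) ^+ 2)%:E).
  have [] // : cintegrable P (fun w => (cmod (Z w) ^+ 2)%:C).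
  by rewrite ZE; apply: cintegrable_sum.
rewrite -[LHS]fineK; last exact: integrable_fin_num.
congr EFin; apply: (@complexI R).
have := cexp_real P (fun w => cmod (Z w) ^+ 2).
rewrite /Rintegral => <-; rewrite ZE cexp_sum// rmorph_sum.
apply: eq_bigr => a aA; rewrite cexp_sum// (bigD1 a)//= big1.
  by rewrite addr0 (cexpZ _ (MM a a).1) (MM a a).2 eqxx mulr1 mul_conjc.
move=> b /andP[bA ba]; rewrite (cexpZ _ (MM a b).1) (MM a b).2.
case: eqP => [/injS ab|_]; last by rewrite mulr0.
by rewrite ab ?eqxx in ba.
Qed.

End Monomials.

(** * Coefficients of the characteristic polynomial *)

Section CharPolyMinors.
Context (F : comNzRingType) (n : nat).
Implicit Type A : 'M[F]_n.

(** The coefficient is the signed sum of the principal k-minors.  In the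
Leibniz formula for det (X - A), J collects the rows where the factor taken is
an entry of A; on the other rows the factor is X, which forces s to fix them. *)
Lemma coef_char_poly_minors A k : (k <= n)%N ->
  (char_poly A)`_(n - k) =
  \sum_(a : {set 'I_n} * 'S_n | (#|a.1| == k) && perm_on a.1 a.2)
    (-1) ^+ (k + a.2) * \prod_(i in a.1) A i (a.2 i).
Proof.
move=> kn.
rewrite -(pair_big_dep (fun J : {set 'I_n} => #|J| == k) (fun J => perm_on J)
  (fun J (s : 'S_n) => (-1) ^+ (k + s) * \prod_(i in J) A i (s i)))/=.
rewrite (exchange_big_dep xpredT)//= /char_poly /determinant coef_sum.
apply: eq_bigr => s _.
have entry i : char_poly_mx A i (s i) = - (A i (s i))%:P + 'X *+ (i == s i).
  by rewrite !mxE addrC.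
under eq_bigr => i _ do rewrite entry.
rewrite bigA_distr mulr_sumr coef_sum big_mkcond [RHS]big_mkcond/=.
apply: eq_bigr => J _; rewrite andbC.
have [Js|] := boolP (perm_on J s); last first.
  move=> nJs; have [i iJ si] : exists2 i, i \notin J & s i != i.
    apply/exists_inP; apply: contraNT nJs => /exists_inPn sJ.
    by apply/fintype.subsetP => i; apply: contraLR => /sJ; rewrite inE negbK.
  by rewrite (bigD1 i)//= (negPf iJ) eq_sym (negPf si) mul0r mulr0 coef0.
have prodJ : \prod_i (if i \in J then - (A i (s i))%:P else 'X *+ (i == s i)) =
    ((-1) ^+ #|J| * \prod_(i in J) A i (s i)) *: 'X^(n - #|J|).
  rewrite (bigID (mem J))/= (eq_bigr (fun i => - (A i (s i))%:P)); last first.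
    by move=> i ->.
  rewrite [X in _ * X](eq_bigr (fun=> 'X)) => [|i iJ]; last first.
    by rewrite (negPf iJ) (out_perm Js)// eqxx.
  rewrite prodrN prodr_const -rmorph_prod -mul_polyC !rmorphM rmorphXn rmorphN1/=.
  have -> : (n - #|J|)%N = #|~: J| by rewrite [RHS]cardsCs finset.setCK card_ord.
  by congr (_ * _ ^+ _); apply: eq_card => i; rewrite !inE.
rewrite prodJ -(rmorphN1 (@polyC F)) -rmorphXn mul_polyC !coefZ coefXn exprD.
have -> : (n - k == n - #|J|)%N = (#|J| == k).
  have := max_card (mem J); rewrite card_ord.
  move=> Jn; apply/eqP/eqP => [/(congr1 (subn n))|->//].
  by rewrite !subKn.
case: eqP => [->|_]; last by rewrite !mulr0.
by rewrite mulr1 mulrA [_ ^+ s * _]mulrC.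
Qed.

End CharPolyMinors.

Section PermutationGraphs.
Context (n : nat).

(** The entries of the matrix that occur in the monomial of (J, s). *)
Definition perm_graph (a : {set 'I_n} * 'S_n) : {set 'I_n * 'I_n} :=
  [set (i, a.2 i) | i in a.1].

(** J is the projection of the graph, s is read off the graph on J, and s fixes
the other indices. *)
Lemma perm_graph_inj k :
  {in [pred a : {set 'I_n} * 'S_n | (#|a.1| == k) && perm_on a.1 a.2] &,
    injective perm_graph}.
Proof.
move=> [J s] [J' s']; rewrite !inE /= => /andP[_ Js] /andP[_ Js'] eqG.
have graphP K (t : 'S_n) i j : ((i, j) \in perm_graph (K, t)) = (i \in K) && (t i == j).
  apply/imsetP/andP => [[i' iK [-> ->]]|[iK /eqP <-]]; first by rewrite eqxx.
  by exists i.
have JJ' : J = J'.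
  apply/setP => i; apply/idP/idP => iJ.
    have : (i, s i) \in perm_graph (J, s) by rewrite graphP iJ eqxx.
    by rewrite eqG graphP => /andP[].
  have : (i, s' i) \in perm_graph (J', s') by rewrite graphP iJ eqxx.
  by rewrite -eqG graphP => /andP[].
congr pair => //; apply/permP => i.
have [iJ|iJ] := boolP (i \in J); last first.
  by rewrite (out_perm Js)// (out_perm Js')// -JJ'.
have : (i, s i) \in perm_graph (J, s) by rewrite graphP iJ eqxx.
by rewrite eqG graphP => /andP[_ /eqP].
Qed.

Lemma card_perm_graph k :
  #|[pred a : {set 'I_n} * 'S_n | (#|a.1| == k) && perm_on a.1 a.2]| = (n ^_ k)%N.
Proof.
rewrite -sum1_card.
rewrite -(pair_big_dep (fun J : {set 'I_n} => #|J| == k) (fun J => perm_on J)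
  (fun _ _ => 1%N))/=.
under eq_bigr => J /eqP Jk do rewrite sum1_card (card_perm J) Jk.
rewrite sum_nat_const -bin_ffact -[in RHS](card_ord n) -card_draws.
by congr (_ * _)%N; apply: eq_card => J; rewrite !inE.
Qed.

Lemma ffact_le_exp k : (n ^_ k <= n ^ k)%N.
Proof.
elim: k n => [|k IHk] [|m]//.
rewrite ffactSS expnS leq_mul2l (leq_trans (IHk m))//.
by case: k {IHk} => // k; rewrite leq_exp2r.
Qed.

End PermutationGraphs.

(** * Spectral radius and characteristic polynomial *)

Lemma prodr_const_seq (F : pzSemiRingType) (I : Type) (s : seq I) (x : F) :
  \prod_(i <- s) x = x ^+ size s.
Proof. by rewrite big_const_seq count_predT iter_mulr_1. Qed.

Section SpectralRadius.
Context (R : realType) (n : nat).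
Implicit Type A : 'M[R[i]]_n.+1.

Lemma char_poly_roots A :
  {rs : seq R[i] | size rs = n.+1 & char_poly A = \prod_(z <- rs) ('X - z%:P)}.
Proof.
have [rs] := closed_field_poly_normal (char_poly A).
rewrite (monicP (char_poly_monic A)) scale1r => charE.
exists rs => //; apply/eqP; rewrite -eqSS -(size_char_poly A) charE.
by rewrite size_prod_XsubC.
Qed.

(** The set of moduli of eigenvalues is nonempty and bounded, being carried by
the finite list of roots, so its supremum is a genuine one. *)
Lemma spectral_radius_gtP A r :
  r < spectral_radius A <-> exists2 l, eigenvalue A l & r < cmod l.
Proof.
have [rs szrs charE] := char_poly_roots A.
have eigE l : eigenvalue A l = (l \in rs).
  by rewrite eigenvalue_root_char charE root_prod_XsubC.
split=> [|[l Al rl]].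
  move=> /sup_gt[]; last by move=> _ [l Al <-] rl; exists l.
  have : head 0 rs \in rs by case: (rs) szrs => //= z s _; rewrite mem_head.
  by rewrite -eigE => Al; exists (cmod (head 0 rs)), (head 0 rs).
apply: (lt_le_trans rl); apply: ub_le_sup; last by exists l.
exists (\sum_(z <- rs) cmod z) => _ [z /= + <-]; rewrite eigE => zrs.
by rewrite (big_rem z zrs)/= lerDl sumr_ge0// => ? _; exact: cmod_ge0.
Qed.

(** At an eigenvalue l the leading term of the characteristic polynomial is
balanced by the others; divide by |l|^(n+1) and use |l| > r. *)
Lemma ge1_sum_char_poly A r : 1 < r -> r < spectral_radius A ->
  1 <= \sum_(i < n.+1) cmod (char_poly A)`_i * r ^- (n.+1 - i).
Proof.
move=> r1 /spectral_radius_gtP[l]; rewrite eigenvalue_root_char => /rootP + rl.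
rewrite horner_coef size_char_poly big_ord_recr/=.
have := char_poly_monic A; rewrite monicE lead_coefE size_char_poly/= => /eqP ->.
rewrite mul1r addrC => /eqP; rewrite addr_eq0 => /eqP lE.
have r0 : 0 < r by apply: lt_trans r1.
have l0 : 0 < cmod l by exact: lt_trans rl.
have : cmod l ^+ n.+1 <= \sum_(i < n.+1) cmod (char_poly A)`_i * cmod l ^+ i.
  rewrite -cmodX lE cmodN (le_trans (cmod_sum _ _))//.
  by apply: ler_sum => i _; rewrite cmodM cmodX.
rewrite -[X in X <= _]mul1r -ler_pdivlMr ?exprn_gt0// mulr_suml => /le_trans; apply.
apply: ler_sum => i _; rewrite -mulrA ler_wpM2l ?cmod_ge0//.
have ni : (n.+1 - i + i)%N = n.+1 by rewrite subnK// ltnW.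
rewrite -[X in _ / cmod l ^+ X]ni exprD invfM mulrCA mulfV ?expf_neq0 ?gt_eqF//.
by rewrite mulr1 lef_pV2 ?posrE ?exprn_gt0// lerXn2r ?nnegrE// ltW.
Qed.

Lemma rat_dense_complex (l : R[i]) e : 0 < e ->
  exists q : rat * rat, cmod ((ratr q.1 +i* ratr q.2) - l) < e.
Proof.
move=> e0; have near (x : R) : exists q : rat, `|ratr q - x| < e / 2.
  have [|q] := @rat_in_itvoo _ (x - e / 2) (x + e / 2); first lra.
  by rewrite in_itv /= => qx; exists q; rewrite ltr_norml; lra.
have [[q1 h1] [q2 h2]] := (near (complex.Re l), near (complex.Im l)).
exists (q1, q2); apply: le_lt_trans (le_cmod_ReIm _) _.
case: l h1 h2 => x y /= h1 h2; lra.
Qed.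

(** If all eigenvalues have modulus at most r and |z| > r, then each factor of
prod (z - l) has modulus at least |z| - r, so the strict inequality fails at
every such z.  Near an eigenvalue of modulus larger than r, on the other hand,
the left-hand side is close to 0 and the right-hand side bounded below, so that
a Gaussian rational z satisfies it. *)
Lemma spectral_radius_gt_rat A r : r < spectral_radius A <->
  exists q : rat * rat, let z := ratr q.1 +i* ratr q.2 in
    r < cmod z /\ cmod (char_poly A).[z] < (cmod z - r) ^+ n.+1.
Proof.
have [rs szrs charE] := char_poly_roots A.
have eigE l : eigenvalue A l = (l \in rs).
  by rewrite eigenvalue_root_char charE root_prod_XsubC.
have hornerE z : cmod (char_poly A).[z] = \prod_(l <- rs) cmod (z - l).
  rewrite charE horner_prod cmod_prod; apply: eq_bigr => l _.
  by rewrite hornerXsubC.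
rewrite spectral_radius_gtP; split=> [[l + rl]|[q]]; last first.
  move: (_ +i* _) => z /= [rz].
  rewrite hornerE => small; apply: contrapT => noroot; move: small.
  apply/negP; rewrite -leNgt -szrs -prodr_const_seq.
  rewrite [leLHS]big_seq [leRHS]big_seq; apply: ler_prod => l lrs.
  rewrite subr_ge0 ltW//=.
  have lr : cmod l <= r.
    by rewrite leNgt; apply/negP => rl; apply: noroot; exists l; rewrite ?eigE.
  have := cmodD (z - l) l; rewrite subrK; lra.
rewrite eigE => lrs; pose e := (cmod l - r) / 2.
have e0 : 0 < e by rewrite divr_gt0 ?subr_gt0.
(* K bounds |z - l'| for all roots l', as soon as z is within e of l *)
pose K := e + cmod l + \sum_(z <- rs) cmod z.
have sum0 (s : seq R[i]) : 0 <= \sum_(z <- s) cmod z.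
  by apply: sumr_ge0 => z _; exact: cmod_ge0.
have K0 : 0 < K by rewrite ltr_wpDr// ltr_wpDr// cmod_ge0.
(* so close to l that r + e <= |z| and |z - l| K^n < e^(n+1) *)
have [|q] := @rat_dense_complex l (Num.min e (e ^+ n.+1 / K ^+ n)).
  by rewrite lt_min e0 divr_gt0// exprn_gt0.
rewrite lt_min => /andP[qe qK]; exists q; move: (_ +i* _) qe qK => z qe qK /=.
have ez : e <= cmod z - r.
  have : cmod l <= cmod z + cmod (z - l).
    by rewrite -[X in cmod X <= _](subKr z) -(cmodN (z - l)) cmodD.
  by rewrite /e in qe *; lra.
split; first by rewrite -subr_gt0 (lt_le_trans e0).
apply: lt_le_trans (_ : e ^+ n.+1 <= _); last first.
  by rewrite ler_pXn2r// nnegrE ?ltW// (lt_le_trans e0).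
rewrite hornerE (big_rem l lrs)/=.
apply: le_lt_trans (_ : cmod (z - l) * K ^+ n < _); last first.
  by rewrite -ltr_pdivlMr// exprn_gt0.
rewrite ler_wpM2l ?cmod_ge0//.
have <- : size (rem l rs) = n by rewrite size_rem// szrs.
rewrite -prodr_const_seq.
rewrite [leLHS]big_seq [leRHS]big_seq; apply: ler_prod => z' /mem_rem z'rs.
rewrite cmod_ge0/= /K (big_rem z' z'rs)/=.
have := cmodD (z - l) (l - z'); rewrite addrA subrK => /le_trans; apply.
have := cmodD l (- z'); rewrite cmodN => lz'.
have := sum0 (rem z' rs); lra.
Qed.

End SpectralRadius.

(** * Tail bound and tightness *)

Section RandomCharPoly.
Context (d : measure_display) (T : measurableType d).
Context (R : realType).

Lemma complex_rv_coef_char_poly n (A : T -> 'M[R[i]]_n) i : (i <= n)%N ->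
    (forall j k, complex_rv (fun w => A w j k)) ->
  complex_rv (fun w => (char_poly (A w))`_i).
Proof.
move=> i_n mA.
rewrite -(subKn i_n) (funext (fun w => coef_char_poly_minors (A w) (leq_subr i n))).
apply: complex_rv_sum => a; apply: complex_rvM; first exact: complex_rv_cst.
by apply: complex_rv_prod => j; exact: mA.
Qed.

Lemma measurable_spectral_radius_gt n (A : T -> 'M[R[i]]_n.+1) r :
    (forall j k, complex_rv (fun w => A w j k)) ->
  measurable [set w | r < spectral_radius (A w)].
Proof.
move=> mA; pose z (q : rat * rat) : R[i] := ratr q.1 +i* ratr q.2.
pose F q := [set w | r < cmod (z q) /\
  cmod (char_poly (A w)).[z q] < (cmod (z q) - r) ^+ n.+1].
have -> : [set w | r < spectral_radius (A w)] = \bigcup_q F q.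
  apply/seteqP; split=> w /=.
    by move=> /spectral_radius_gt_rat[q rq]; exists q.
  by move=> [q _ rq]; apply/spectral_radius_gt_rat; exists q.
apply: countable_bigcupT_measurable => [|q]; first exact: countableP.
have [rq|rq] := ltP r (cmod (z q)); last first.
  by rewrite (_ : F q = set0)//; apply/seteqP; split=> w //= []; rewrite ltNge rq.
have mchar : complex_rv (fun w => (char_poly (A w)).[z q]).
  under eq_fun => w do rewrite horner_coef size_char_poly.
  apply: complex_rv_sum => i; apply: complex_rvM; last exact: complex_rv_cst.
  by apply: complex_rv_coef_char_poly => //; rewrite -ltnS.
have := measurable_cmod_sqr mchar measurableT
  (measurable_itv `]-oo, ((cmod (z q) - r) ^+ n.+1) ^+ 2[).
rewrite setTI; congr measurable; apply/seteqP; split=> w /=; rewrite in_itv/=.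
  by rewrite ltr_pXn2r// ?nnegrE ?cmod_ge0// exprn_ge0// subr_ge0 ltW.
by case=> _; rewrite ltr_pXn2r// ?nnegrE ?cmod_ge0// exprn_ge0// subr_ge0 ltW.
Qed.

End RandomCharPoly.

Lemma sum_inv_powers_le (R : realType) (r : R) n : 1 < r ->
  \sum_(i < n) r ^- (n - i) <= (r - 1)^-1.
Proof.
move=> r1; have rne0 : r != 0 by rewrite gt_eqF//; lra.
have r1ne0 : r - 1 != 0 by rewrite gt_eqF//; lra.
suff -> : \sum_(i < n) r ^- (n - i) = (1 - r ^- n) / (r - 1).
  rewrite ler_piMl ?invr_ge0 ?lerBlDr ?lerDl ?invr_ge0 ?exprn_ge0//; lra.
elim: n => [|n IHn]; first by rewrite big_ord0 expr0 invr1 subrr mul0r.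
rewrite big_ord_recl subn0 (eq_bigr (fun i : 'I_n => r ^- (n - i)))// IHn exprS.
by field; rewrite r1ne0 expf_neq0.
Qed.

Section NormalizedMatrix.
Context (d : measure_display) (T : measurableType d).
Context (R : realType) (P : probability T R) (n : nat).
Context (E : T -> 'M[R[i]]_n.+1).
Context (Emeas : forall i j, complex_rv (fun w => E w i j)).
Context (Eindep :
  mutually_independent P (fun (ij : 'I_n.+1 * 'I_n.+1) w => E w ij.1 ij.2)).
Context (Emean0 : forall i j, centered P (fun w => E w i j)).
Context (Evar1 : forall i j, unit_variance P (fun w => E w i j)).

Let A w := ((Num.sqrt n.+1%:R : R)^-1)%:C *: E w.

(** By orthonormality the second moment is n^(-k) times the number of pairs
(J, s), where n is the size of the matrix; that number is the falling factorial
of n of length k. *)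
Lemma second_moment_coef_char_poly (i : nat) : (i <= n.+1)%N ->
  (\int[P]_w (cmod (char_poly (A w))`_i ^+ 2)%:E <= 1)%E.
Proof.
move=> i_n; pose k := (n.+1 - i)%N; have k_n : (k <= n.+1)%N by exact: leq_subr.
pose s := (Num.sqrt n.+1%:R : R)^-1.
pose c (a : {set 'I_n.+1} * 'S_n.+1) : R[i] := (-1) ^+ (k + a.2) * s%:C ^+ k.
have cE a : cmod (c a) ^+ 2 = (n.+1%:R ^+ k)^-1.
  rewrite /c cmodM !cmodX cmodN cmod1 expr1n mul1r cmodr.
  rewrite ger0_norm ?invr_ge0 ?sqrtr_ge0// -exprM mulnC exprM exprVn.
  by rewrite sqr_sqrtr// exprVn.
have coefE w : (char_poly (A w))`_i =
    \sum_(a in [pred a : {set 'I_n.+1} * 'S_n.+1 |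
                (#|a.1| == k) && perm_on a.1 a.2])
      c a * monomial (fun ij w => E w ij.1 ij.2) (perm_graph a) w.
  rewrite -(subKn i_n) -/k coef_char_poly_minors//; apply: eq_bigr => a.
  move=> /andP[/eqP ak _]; rewrite /c -mulrA; congr (_ * _).
  rewrite -{1}ak -prodr_const /monomial /perm_graph big_imset/=; last first.
    by move=> j j' _ _ [].
  by rewrite -big_split; apply: eq_bigr => j _; rewrite mxE.
under eq_integral => w _ do rewrite coefE.
rewrite (second_moment_monomials c _ Eindep)//; last first.
- exact: perm_graph_inj.
rewrite lee_fin (eq_bigr _ (fun a _ => cE a)) sumr_const card_perm_graph.
rewrite -[_ *+ _]mulr_natl ler_pdivrMr ?exprn_gt0// mul1r -natrX ler_nat.
exact: ffact_le_exp.
Qed.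

Lemma spectral_radius_tail r : 1 < r ->
  (P [set w | (r < spectral_radius (A w))%R] <= ((r - 1)^-1)%:E)%E.
Proof.
move=> r1.
have mA i j : complex_rv (fun w => A w i j).
  rewrite /A; under eq_fun => w do rewrite mxE.
  by apply: complex_rvM; [exact: complex_rv_cst|exact: Emeas].
have mQ (i : 'I_n.+1) : measurable_fun setT (fun w => cmod (char_poly (A w))`_i ^+ 2).
  apply: measurable_cmod_sqr.
  by apply: complex_rv_coef_char_poly => //; exact: ltnW.
(* from |a| <= (1 + |a|^2)/2, so that only second moments are needed *)
pose Y w := \sum_(i < n.+1)
  (1 + cmod (char_poly (A w))`_i ^+ 2) * (r ^- (n.+1 - i) / 2).
have r0 : 0 < r by lra.
have w0 (i : 'I_n.+1) : 0 <= r ^- (n.+1 - i) / 2.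
  by rewrite divr_ge0// invr_ge0 exprn_ge0 ?ltW.
have mterm (i : 'I_n.+1) : measurable_fun setT (fun w =>
    (1 + cmod (char_poly (A w))`_i ^+ 2) * (r ^- (n.+1 - i) / 2)).
  by apply: measurable_funM => //; exact: measurable_funD.
have mY : measurable_fun setT Y by apply: measurable_sum.
have Y0 w : 0 <= Y w.
  by apply: sumr_ge0 => i _; rewrite mulr_ge0// addr_ge0// sqr_ge0.
have mYE : measurable_fun setT (EFin \o Y) by exact/measurable_EFinP.
pose M := [set w | 1 <= Y w].
have markov : (P M <= \int[P]_w (Y w)%:E)%E.
  have := le_integral_abse P measurableT mYE ltr01.
  rewrite mul1e setTI (_ : [set w | _] = M); last first.
    by apply/seteqP; split=> w; rewrite /M /= lee_fin ger0_norm.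
  move=> /le_trans; apply; rewrite le_eqVlt; apply/orP; left.
  by apply/eqP; apply: eq_integral => w _ /=; rewrite ger0_norm.
have subY : [set w | r < spectral_radius (A w)] `<=` M.
  move=> w /= /(ge1_sum_char_poly r1) ge1; rewrite /M /=.
  apply: (le_trans ge1); apply: ler_sum => i _; set x := cmod _.
  rewrite [leRHS]mulrCA mulrC ler_wpM2l ?invr_ge0 ?exprn_ge0 ?(ltW r0)//.
  by have := sqr_ge0 (x - 1); rewrite sqrrB1 => ?; lra.
have mM : measurable M.
  have := mY measurableT _ (measurable_itv `[1, +oo[); rewrite setTI.
  by congr measurable; apply/seteqP; split=> w; rewrite /M /= in_itv/= andbT.
apply: (le_trans (le_measure P _ _ subY)); rewrite ?inE//.
  exact: measurable_spectral_radius_gt.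
apply: (le_trans markov).
under eq_integral => w _ do rewrite -sumEFin.
rewrite ge0_integral_sum//; first last.
- by move=> i w _; rewrite lee_fin mulr_ge0// addr_ge0// sqr_ge0.
- by move=> i; exact/measurable_EFinP.
apply: (@le_trans _ _ (\sum_(i < n.+1) (r ^- (n.+1 - i))%:E)%E).
  apply: lee_sum => i _; under eq_integral => w _ do rewrite mulrC EFinM.
  rewrite ge0_integralZl_EFin//; first last.
  - apply/measurable_EFinP; exact: measurable_funD.
  - by move=> w _; rewrite lee_fin addr_ge0// sqr_ge0.
  under eq_integral => w _ do rewrite EFinD.
  rewrite ge0_integralD//; first last.
  - exact/measurable_EFinP.
  - by move=> w _; rewrite lee_fin sqr_ge0.
  have -> : (\int[P]_w 1%:E = 1)%E.
    by rewrite integral_cst// mul1e; exact: probability_setT.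
  have Q1 := second_moment_coef_char_poly (ltnW (ltn_ord i)).
  apply: (@le_trans _ _ ((r ^- (n.+1 - i) / 2)%:E * (1 + 1)))%E.
    by apply: lee_wpmul2l; rewrite ?lee_fin// leeD2l.
  by rewrite -EFinD -EFinM lee_fin divfK.
by rewrite sumEFin lee_fin; exact: sum_inv_powers_le.
Qed.

End NormalizedMatrix.

(* E N is the matrix of size N.+1, so that the sizes are the positive integers;
   each matrix may live on its own probability space. *)
Theorem propositionA1 (R : realType) (d : nat -> measure_display)
    (T : forall N : nat, measurableType (d N))
    (P : forall N : nat, probability (T N) R)
    (E : forall N : nat, T N -> 'M[R[i]]_N.+1)
    (Emeas : forall (N : nat) (i j : 'I_N.+1), complex_rv (fun w => E N w i j))
    (Eindep : forall N : nat,
      mutually_independent (P N)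
        (fun (ij : 'I_N.+1 * 'I_N.+1) w => E N w ij.1 ij.2))
    (Emean0 : forall (N : nat) (i j : 'I_N.+1),
      centered (P N) (fun w => E N w i j))
    (Evar1 : forall (N : nat) (i j : 'I_N.+1),
      unit_variance (P N) (fun w => E N w i j)) :
  tight P (fun N w =>
    spectral_radius (((Num.sqrt N.+1%:R : R)^-1)%:C *: E N w)).
Proof.
rewrite /tight; set f := (f in f r @[r --> _]).
have f0 r : (0 <= f r)%E.
  apply: (@le_trans _ _ (P 0 [set w |
    r < spectral_radius (((Num.sqrt 1%:R : R)^-1)%:C *: E 0 w)])) => //.
  by apply: ereal_sup_ubound; exists 0%N.
have fr r : 1 < r -> (f r <= ((r - 1)^-1)%:E)%E.
  move=> r1; apply: ge_ereal_sup => _ [N _ <-].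
  exact: spectral_radius_tail.
apply: (@squeeze_cvge _ _ _ _ (fun=> 0%E) _ (fun r => ((r - 1)^-1)%:E)).
- near=> r; rewrite f0 fr//; near: r; exact: nbhs_pinfty_gt.
- exact: cvg_cst.
- have inv0 : (r - 1)^-1 @[r --> +oo] --> (0 : R).
    apply/gtr0_cvgV0; last exact: cvg_addrr.
    by near=> r; rewrite subr_gt0; near: r; exact: nbhs_pinfty_gt.
  by apply/cvg_EFin; first by near=> r.
Unshelve. all: by end_near.
Qed.
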